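(* Let $\eta$ be any positive equivalence relation such that at least one $\eta$-family is finitely learnable. Then there are finitely learnable $\eta$-families $\mathcal L_1$ and $\mathcal L_2$ such that $\mathcal L_1\cup\mathcal L_2$ is an $\eta$-family that is not finitely learnable. Furthermore, $\mathcal L_2\setminus\mathcal L_1$ contains exactly one language.
   Context: A positive equivalence relation is an equivalence relation $\eta$ on $\mathbb{N}$ that is recursively enumerable (as a set of pairs) and has infinitely many equivalence classes. A set is $\eta$-closed if it is a union of $\eta$-classes. An $\eta$-family is an infinite family of $\eta$-closed sets possessing a uniformly r.e. one-one numbering $B_0,B_1,\dots$ (i.e. $\{\langle k,x\rangle:x\in B_k\}$ is r.e. and $B_i\neq B_j$ for $i\ne j$). $W_0,W_1,\dots$ is a fixed acceptable numbering of the r.e. sets. A text for $L$ is a total $T:\mathbb N\to\mathbb N\cup\{\#\}$ whose range minus $\{\#\}$ is $L$; $T[n]$ is its initial segment of length $n$. A learner is a recursive function $M$ from finite sequences over $\mathbb N\cup\{\#\}$ to $\mathbb N\cup\{?\}$; an output $e$ is interpreted as the hypothesis ''the $\eta$-closure of $W_e$''. A family $\mathcal C$ is finitely learnable if some $M$, on every text $T$ for every $L\in\mathcal C$, has an $n$ with $M(T[m])=?$ for all $m<n$, $M(T[j])=M(T[n])$ for all $j\ge n$, and the hypothesis of $M(T[n])$ equal to $L$. *)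

(* Defs.v *)
From mathcomp Require Import all_boot.
From mathcomp Require Import boolp classical_sets functions cardinality.

Set Implicit Arguments.
Unset Strict Implicit.
Unset Printing Implicit Defensive.

Local Open Scope classical_set_scope.

(* Kleene's mu-recursive programs. Arities are not tracked by the type; an
   instruction needing an entry beyond the argument vector has no value. *)
Inductive prog : Type :=
| Zero
| Succ
| Proj of nat
| Comp of prog & seq prog
| PrimRec of prog & prog
| Mu of prog.

(* [eval p v y]: the partial function computed by p is defined on the argument
   vector v and has value y there. *)
Inductive eval : prog -> seq nat -> nat -> Prop :=
| EvalZero v : eval Zero v 0
| EvalSucc x v : eval Succ (x :: v) x.+1
| EvalProj i v : i < size v -> eval (Proj i) v (nth 0 v i)
| EvalComp p qs v ys y :
    evals qs v ys -> eval p ys y -> eval (Comp p qs) v y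
| EvalPrimRec0 p q v y : eval p v y -> eval (PrimRec p q) (0 :: v) y
| EvalPrimRecS p q n v y z :
    eval (PrimRec p q) (n :: v) y -> eval q [:: n, y & v] z ->
    eval (PrimRec p q) (n.+1 :: v) z
| EvalMu p v n (k : nat -> nat) :
    (forall m, m < n -> eval p (m :: v) (k m).+1) -> eval p (n :: v) 0 ->
    eval (Mu p) v n
with evals : seq prog -> seq nat -> seq nat -> Prop :=
| EvalsNil v : evals [::] v [::]
| EvalsCons p ps v y ys :
    eval p v y -> evals ps v ys -> evals (p :: ps) v (y :: ys).

Definition recursive (f : nat -> nat) : Prop :=
  exists p, forall x, eval p [:: x] (f x).

Definition re_set (A : set nat) : Prop :=
  A = set0 \/ exists2 f, recursive f & A = range f.

(* The bijection CodeSeq.code : seq nat -> nat codes both pairs and finite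
   sequences. *)
Definition re_rel (R : nat -> nat -> Prop) : Prop :=
  re_set [set CodeSeq.code [:: p.1; p.2] | p in [set p | R p.1 p.2]].

(* [W] is a numbering of r.e. sets, uniformly in the index, into which every
   uniformly r.e. numbering can be translated recursively. *)
Definition acceptable (W : nat -> set nat) : Prop :=
  re_rel W /\
  forall V : nat -> set nat, re_rel V ->
    exists2 f, recursive f & forall e, W (f e) = V e.

Section EtaFamilies.

Variable eta : nat -> nat -> Prop.

Definition eta_class (x : nat) : set nat := [set y | eta x y].

Definition positive_equivalence : Prop :=
  [/\ RelationClasses.Equivalence eta, re_rel eta
    & infinite_set (range eta_class)].

Definition eta_closed (A : set nat) : Prop :=
  exists2 S : set (set nat), S `<=` range eta_class & A = \bigcup_(C in S) C.

Definition eta_closure (A : set nat) : set nat := \bigcup_(x in A) eta_class x.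

Definition eta_family (L : set (set nat)) : Prop :=
  [/\ infinite_set L, L `<=` eta_closed
    & exists B : nat -> set nat, [/\ L = range B, injective B & re_rel B]].

End EtaFamilies.

(* In a text, [None] is the pause symbol #. *)
Definition text_for (T : nat -> option nat) (A : set nat) : Prop :=
  A = [set x | exists n, T n = Some x].

Definition code_option (o : option nat) : nat := oapp S 0 o.

Definition code_segment (s : seq (option nat)) : nat :=
  CodeSeq.code (map code_option s).

(* In the output of a learner, [None] is the symbol ?. *)
Definition recursive_learner (M : seq (option nat) -> option nat) : Prop :=
  exists2 f, recursive f & forall s, f (code_segment s) = code_option (M s).

(* [mkseq T n] is the initial segment T[n] of length n. *)
Definition finitely_learnable (W : nat -> set nat) (eta : nat -> nat -> Prop)
    (L : set (set nat)) : Prop :=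
  exists2 M, recursive_learner M &
    forall A, L A -> forall T, text_for T A ->
      exists n, [/\ forall m, m < n -> M (mkseq T m) = None,
        forall j, n <= j -> M (mkseq T j) = M (mkseq T n)
        & exists2 e, M (mkseq T n) = Some e & eta_closure eta (W e) = A].

(* Main.v *)
(* Let [M] finitely learn the one-one numbered eta-family [B]. On a text of
   [B i], let [d i] code the segment on which [M] first makes a hypothesis. As
   [M] never revises it, [content (d i)] is contained in [B j] only for
   [j = i]. Hence the closures of the finite sets [content (d i)] are again a
   learnable eta-family, indeed an antichain with computable finite tell-tales.
   Let [U] be the closure of the union of [content (d 0)] and [content (d 1)]:
   as [U] is a union of finitely many classes, it includes only finitely many
   members of the antichain. Dropping those, the rest of the antichain stays
   learnable when the 0-th member is put back (L1) or when [U] is added (L2),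
   but not with both, since the 0-th member is a proper subset of [U]. *)
Require Import Defs.
From mathcomp Require Import all_boot.
From mathcomp Require Import boolp classical_sets functions cardinality.

Set Implicit Arguments.
Unset Strict Implicit.
Unset Printing Implicit Defensive.

Local Open Scope classical_set_scope.

(** * Recursive functions and recursively enumerable relations *)

(* A function of [n] arguments is written as a function of an environment [e]
   whose first [n] values are the arguments. Binding a variable shifts the
   environment: the bound variable becomes [e 0]. *)
Definition computable (n : nat) (F : (nat -> nat) -> nat) : Prop :=
  exists p, forall e, eval p (mkseq e n) (F e).

Lemma recursiveE (f : nat -> nat) :
  recursive f <-> computable 1 (fun e => f (e 0)).
Proof.
split=> -[p Hp]; exists p => x; first exact: Hp.
exact: (Hp (fun=> x)).
Qed.

Lemma mkseq_cons (e : nat -> nat) n :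
  mkseq e n.+1 = e 0 :: mkseq (fun i => e i.+1) n.
Proof. by rewrite /mkseq /= -add1n iotaDl -map_comp. Qed.

Definition env_cons (m : nat) (e : nat -> nat) (i : nat) : nat :=
  if i is j.+1 then e j else m.

Lemma mkseq_env_cons m e n : mkseq (env_cons m e) n.+1 = m :: mkseq e n.
Proof. exact: mkseq_cons. Qed.

Lemma eq_computable n F G :
  (forall e, F e = G e) -> computable n F -> computable n G.
Proof. by move=> FG [p Hp]; exists p => e; rewrite -FG. Qed.

Lemma computable_var n k : k < n -> computable n (fun e => e k).
Proof.
move=> kn; exists (Proj k) => e; rewrite -(nth_mkseq 0 e kn).
by apply: EvalProj; rewrite size_mkseq.
Qed.

Lemma computable_app1 n f F :
  recursive f -> computable n F -> computable n (fun e => f (F e)).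
Proof.
move=> [p Hp] [q Hq]; exists (Comp p [:: q]) => e.
by apply: EvalComp (Hp _); do 2?constructor.
Qed.

Lemma computable_app2 n f F G :
  computable 2 (fun e => f (e 0) (e 1)) -> computable n F -> computable n G ->
  computable n (fun e => f (F e) (G e)).
Proof.
move=> [p Hp] [q Hq] [r Hr]; exists (Comp p [:: q; r]) => e.
apply: EvalComp (Hp (fun i => nth 0 [:: F e; G e] i)).
by do 3?constructor.
Qed.

Lemma computable_app3 n f F G H :
  computable 3 (fun e => f (e 0) (e 1) (e 2)) ->
  computable n F -> computable n G -> computable n H ->
  computable n (fun e => f (F e) (G e) (H e)).
Proof.
move=> [p Hp] [q Hq] [r Hr] [s Hs]; exists (Comp p [:: q; r; s]) => e.
apply: EvalComp (Hp (fun i => nth 0 [:: F e; G e; H e] i)).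
by do 4?constructor.
Qed.

Lemma evals_proj (e r : nat -> nat) n k : (forall i, i < k -> r i < n) ->
  evals (mkseq (fun i => Proj (r i)) k) (mkseq e n) (mkseq (fun i => e (r i)) k).
Proof.
move=> rn; rewrite /mkseq.
have: all (ltn^~ k) (iota 0 k) by apply/allP => i; rewrite mem_iota.
elim: (iota 0 k) => [|i s IHs] /= => [_|/andP[ik sk]]; first by constructor.
constructor; last exact: IHs.
have <- : nth 0 (mkseq e n) (r i) = e (r i) by rewrite nth_mkseq ?rn.
by apply: EvalProj; rewrite size_mkseq rn.
Qed.

(** Moves a program under further binders, where its variables sit at other positions. *)
Lemma computable_rename n k r F :
  (forall i, i < k -> r i < n) -> computable k F ->
  computable n (fun e => F (fun i => e (r i))).
Proof.
move=> rn [p Hp]; exists (Comp p (mkseq (fun i => Proj (r i)) k)) => e.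
exact: EvalComp (evals_proj e rn) (Hp _).
Qed.

Lemma recursive_succ : recursive S.
Proof. by exists Succ => x; constructor. Qed.

Lemma computable_succ n F : computable n F -> computable n (fun e => (F e).+1).
Proof. exact: computable_app1 recursive_succ. Qed.

Lemma computable_const n c : computable n (fun=> c).
Proof.
elim: c => [|c IHc]; last exact: computable_succ.
by exists Zero => e; constructor.
Qed.

(** In the step function, the counter and the previous value occupy positions 0 and 1, so the
    parameters appear shifted by two. *)
Lemma computable_rec n B S K :
  computable n B ->
  computable n.+2 (fun e => S (e 0) (e 1) (fun i => e i.+2)) ->
  computable n K ->
  computable n (fun e => nat_rect (fun=> nat) (B e) (fun m y => S m y e) (K e)).
Proof.
move=> [b Hb] [s Hs] [k Hk].
exists (Comp (PrimRec b s) (k :: mkseq Proj n)) => e.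
apply: (@EvalComp _ _ _ (K e :: mkseq e n)).
  by constructor => //; apply: (@evals_proj e id).
elim: (K e) => [|m IHm] /=; first by constructor.
apply: EvalPrimRecS IHm _.
set y := nat_rect _ _ _ m.
have := Hs (env_cons m (env_cons y e)).
by rewrite !mkseq_env_cons.
Qed.

(** [Mu] looks for the value 0, so the program evaluates the negation of [P]. The last two
    conditions make [f e] the least witness, where the search stops. *)
Lemma computable_mu n (P : nat -> (nat -> nat) -> bool) f :
  computable n.+1 (fun e => ~~ P (e 0) (fun i => e i.+1)) ->
  (forall e, P (f e) e) -> (forall e m, P m e -> f e <= m) ->
  computable n f.
Proof.
move=> [p Hp] Pf f_min; exists (Mu p) => e.
have Hpm m : eval p (m :: mkseq e n) (~~ P m e).
  by have := Hp (env_cons m e); rewrite mkseq_env_cons.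
(* Before the least witness the negation has the value 1, the successor of 0. *)
apply: (@EvalMu _ _ _ (fun=> 0)) => [m m_lt|]; last first.
  by have := Hpm (f e); rewrite Pf.
have := Hpm m; suff -> : P m e = false by [].
by apply: contraTF m_lt => /f_min; rewrite -leqNgt.
Qed.

Lemma computable_pred n F : computable n F -> computable n (fun e => (F e).-1).
Proof.
move=> HF; apply: eq_computable
  (@computable_rec n (fun=> 0) (fun m _ _ => m) F _ _ _) => //.
- by move=> e; case: (F e).
- exact: computable_const.
- exact: computable_var.
Qed.

Lemma computable_add n F G :
  computable n F -> computable n G -> computable n (fun e => F e + G e).
Proof.
move=> HF HG.
apply: eq_computable (@computable_rec n F (fun _ y _ => y.+1) G HF _ HG).
  by move=> e; elim: (G e) => [|m /= ->]; rewrite ?addn0 ?addnS.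
by apply: computable_succ; apply: computable_var.
Qed.

Lemma computable_mul n F G :
  computable n F -> computable n G -> computable n (fun e => F e * G e).
Proof.
apply: (@computable_app2 n muln).
apply: eq_computable
  (@computable_rec 2 (fun=> 0) (fun _ y e => y + e 0) (fun e => e 1) _ _ _).
- by move=> e; elim: (e 1) => [|m /= ->]; rewrite ?muln0 ?mulnS 1?addnC.
- exact: computable_const.
- by apply: computable_add; apply: computable_var.
- exact: computable_var.
Qed.

Lemma computable_sub n F G :
  computable n F -> computable n G -> computable n (fun e => F e - G e).
Proof.
move=> HF HG.
apply: eq_computable (@computable_rec n F (fun _ y _ => y.-1) G HF _ HG).
  by move=> e; elim: (G e) => [|m /= ->]; rewrite ?subn0 ?subnS.
by apply: computable_pred; apply: computable_var.
Qed.

Lemma computable_exp2 n F : computable n F -> computable n (fun e => 2 ^ F e).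
Proof.
apply: (@computable_app1 n (expn 2)); apply/recursiveE.
apply: eq_computable
  (@computable_rec 1 (fun=> 1) (fun _ y _ => y + y) (fun e => e 0) _ _ _).
- by move=> e; elim: (e 0) => [|m /= ->]; rewrite ?addnn -?mul2n ?expnS.
- exact: computable_const.
- by apply: computable_add; apply: computable_var.
- exact: computable_var.
Qed.

(** Truth values are coerced to 0 and 1, so case distinction and the connectives below reduce to
    arithmetic. *)
Lemma computable_if n (b : (nat -> nat) -> bool) F G :
  computable n b -> computable n F -> computable n G ->
  computable n (fun e => if b e then F e else G e).
Proof.
move=> Hb HF HG.
apply: eq_computable
  (computable_add (computable_mul Hb HF)
     (computable_mul (computable_sub (computable_const n 1) Hb) HG)).
by move=> e; case: (b e); rewrite ?mul1n ?addn0.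
Qed.

Lemma computable_negb n (b : (nat -> nat) -> bool) :
  computable n b -> computable n (fun e => ~~ b e).
Proof.
move=> Hb; apply: eq_computable (computable_sub (computable_const n 1) Hb).
by move=> e; case: (b e).
Qed.

Lemma computable_andb n (b c : (nat -> nat) -> bool) :
  computable n b -> computable n c -> computable n (fun e => b e && c e).
Proof.
move=> Hb Hc; apply: eq_computable (computable_mul Hb Hc).
by move=> e; rewrite mulnb.
Qed.

Lemma computable_orb n (b c : (nat -> nat) -> bool) :
  computable n b -> computable n c -> computable n (fun e => b e || c e).
Proof.
move=> Hb Hc.
apply: eq_computable
  (computable_negb (computable_andb (computable_negb Hb) (computable_negb Hc))).
by move=> e; rewrite -negb_or negbK.
Qed.

Lemma computable_leq n F G :
  computable n F -> computable n G -> computable n (fun e => F e <= G e).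
Proof.
move=> HF HG.
apply: eq_computable
  (computable_sub (computable_const n 1) (computable_sub HF HG)).
by move=> e; rewrite -subn_eq0; case: (F e - G e).
Qed.

Lemma computable_eqn n F G :
  computable n F -> computable n G -> computable n (fun e => F e == G e).
Proof.
move=> HF HG.
apply: eq_computable
  (computable_andb (computable_leq HF HG) (computable_leq HG HF)).
by move=> e; rewrite -eqn_leq.
Qed.

Lemma computable_has n (P : nat -> (nat -> nat) -> bool) K :
  computable n.+1 (fun e => P (e 0) (fun i => e i.+1)) ->
  computable n K ->
  computable n (fun e => has (fun m => P m e) (iota 0 (K e))).
Proof.
move=> HP HK.
(* [r] skips position 1, which holds the truth value accumulated by the recursion. *)
pose r i := if i is j.+1 then j.+2 else 0.
apply: eq_computable
  (@computable_rec n (fun=> 0)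
    (fun m y e => (y == 1) || P m e) K (computable_const n 0) _ HK).
  move=> e; elim: (K e) => [|m IHm] //.
  have -> : iota 0 m.+1 = rcons (iota 0 m) m by rewrite -addn1 iotaD cats1.
  by rewrite has_rcons orbC [LHS]/= IHm eqb1.
apply: computable_orb.
  by apply: computable_eqn; [apply: computable_var | apply: computable_const].
by apply: (@computable_rename n.+2 n.+1 r _ _ HP) => -[].
Qed.

Lemma computable_all n (P : nat -> (nat -> nat) -> bool) K :
  computable n.+1 (fun e => P (e 0) (fun i => e i.+1)) ->
  computable n K ->
  computable n (fun e => all (fun m => P m e) (iota 0 (K e))).
Proof.
move=> HP HK.
apply: eq_computable
  (computable_negb (@computable_has n (fun m e => ~~ P m e) K
     (computable_negb HP) HK)).
by move=> e; rewrite has_predC negbK.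
Qed.

Lemma computable_find n (P : nat -> (nat -> nat) -> bool) K :
  computable n.+1 (fun e => P (e 0) (fun i => e i.+1)) ->
  computable n K ->
  computable n (fun e => find (fun m => P m e) (iota 0 (K e))).
Proof.
move=> HP HK.
(* An unsuccessful [find] returns the length of the list; the second disjunct stops the search
   there. *)
apply: (@computable_mu n (fun m e => P m e || (K e <= m))).
- apply/computable_negb/computable_orb => //.
  apply: computable_leq; last exact: computable_var.
  exact: (@computable_rename n.+1 n S).
- move=> e; case: ltnP; rewrite ?orbT // => lt_K.
  have has_P : has (P^~ e) (iota 0 (K e)) by rewrite has_find size_iota.
  by have := nth_find 0 has_P; rewrite nth_iota // orbF.
- move=> e m /orP[Pm|Km]; last first.
    by apply: leq_trans Km; rewrite -{2}(size_iota 0 (K e)) find_size.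
  rewrite leqNgt; apply/negP => lt_m.
  have := before_find 0 lt_m; rewrite nth_iota ?Pm //.
  by apply: leq_trans lt_m _; rewrite -{2}(size_iota 0 (K e)) find_size.
Qed.

(** * Computing with coded sequences *)

Definition code_head (c : nat) : nat := head 0 (CodeSeq.decode c).

Definition code_tail (c : nat) : nat := CodeSeq.code (behead (CodeSeq.decode c)).

Lemma code_head_cons x s : code_head (CodeSeq.code (x :: s)) = x.
Proof. by rewrite /code_head CodeSeq.codeK. Qed.

Lemma code_tail_cons x s : code_tail (CodeSeq.code (x :: s)) = CodeSeq.code s.
Proof. by rewrite /code_tail CodeSeq.codeK. Qed.

(** The product is what [CodeSeq.code] assigns to a sequence with head [F e] and a tail coded by
    [G e]. *)
Lemma computable_code_cons n F G : computable n F -> computable n G ->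
  computable n (fun e => 2 ^ F e * (G e).*2.+1).
Proof.
move=> HF HG; apply: computable_mul; first exact: computable_exp2.
apply: computable_succ; apply: eq_computable (computable_add HG HG).
by move=> e; rewrite addnn.
Qed.

Lemma code_cons_decode h t : 2 ^ h * t.*2.+1 = CodeSeq.code (h :: CodeSeq.decode t).
Proof. by rewrite /= CodeSeq.decodeK. Qed.

Lemma computable_code_head n F :
  computable n F -> computable n (fun e => code_head (F e)).
Proof.
apply: (@computable_app1 n code_head); apply/recursiveE.
(* The code 0 of the empty sequence is not such a product; its clause makes the search return the
   default head 0. Otherwise the code exceeds the code [t] of its tail, so [t] may be searched below
   it. *)
apply: (@computable_mu 1 (fun h e =>
  (e 0 == 0) || has (fun t => 2 ^ h * t.*2.+1 == e 0) (iota 0 (e 0)))).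
- apply/computable_negb/computable_orb.
    by apply: computable_eqn; [apply: computable_var | apply: computable_const].
  apply: (@computable_has 2 (fun t e => 2 ^ e 0 * t.*2.+1 == e 1) (fun e => e 1)).
    apply: computable_eqn; last exact: computable_var.
    by apply: computable_code_cons; apply: computable_var.
  exact: computable_var.
- move=> e; case: eqVneq => //= c0; apply/hasP; exists (code_tail (e 0)).
    rewrite mem_iota /= add0n -{2}[e 0]CodeSeq.decodeK /code_tail.
    case: (CodeSeq.decode (e 0)) (CodeSeq.decodeK (e 0)) => [/= /esym/eqP|h s _ /=].
      by rewrite (negbTE c0).
    apply: leq_trans (leq_pmull _ _); last by rewrite expn_gt0.
    by rewrite ltnS -addnn leq_addr.
  apply/eqP; rewrite code_cons_decode /code_tail CodeSeq.codeK /code_head.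
  rewrite -[RHS]CodeSeq.decodeK.
  case: (CodeSeq.decode (e 0)) (CodeSeq.decodeK (e 0)) => //= /esym/eqP.
  by rewrite (negbTE c0).
- move=> e m; case: eqVneq => [->//|c0] /= /hasP[t _ /eqP <-].
  by rewrite code_cons_decode /code_head CodeSeq.codeK.
Qed.

Lemma computable_code_tail n F :
  computable n F -> computable n (fun e => code_tail (F e)).
Proof.
apply: (@computable_app1 n code_tail); apply/recursiveE.
apply: (@computable_mu 1 (fun t e =>
  (e 0 == 0) || (2 ^ code_head (e 0) * t.*2.+1 == e 0))).
- apply/computable_negb/computable_orb.
    by apply: computable_eqn; [apply: computable_var | apply: computable_const].
  apply: computable_eqn; last exact: computable_var.
  apply: computable_code_cons; last exact: computable_var.
  by apply: computable_code_head; apply: computable_var.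
- move=> e; case: eqVneq => //= c0.
  apply/eqP; rewrite code_cons_decode /code_tail CodeSeq.codeK /code_head.
  rewrite -[RHS]CodeSeq.decodeK.
  case: (CodeSeq.decode (e 0)) (CodeSeq.decodeK (e 0)) => //= /esym/eqP.
  by rewrite (negbTE c0).
- move=> e m; case: eqVneq => [->//|c0] /= /eqP <-.
  by rewrite code_cons_decode /code_tail CodeSeq.codeK /= CodeSeq.decodeK.
Qed.

Lemma size_decode c : size (CodeSeq.decode c) <= c.
Proof.
rewrite -{2}[c]CodeSeq.decodeK; elim: (CodeSeq.decode c) => //= x s IHs.
apply: leq_trans (leq_pmull _ _); last by rewrite expn_gt0.
by rewrite ltnS -addnn (leq_trans IHs) ?leq_addr.
Qed.

Lemma decode_iter_code_tail k c :
  CodeSeq.decode (iter k code_tail c) = drop k (CodeSeq.decode c).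
Proof.
elim: k => [|k IHk]; first by rewrite drop0.
by rewrite iterS {1}/code_tail CodeSeq.codeK IHk -drop1 drop_drop.
Qed.

(** By [size_decode] all positions lie below the code. A position past the end reads 0, which is
    never mistaken for a successor. *)
Lemma computable_mem_decode n F G : computable n F -> computable n G ->
  computable n (fun e => (F e).+1 \in CodeSeq.decode (G e)).
Proof.
apply: (@computable_app2 n (fun x c => x.+1 \in CodeSeq.decode c)).
apply: eq_computable (@computable_has 2 (fun k e =>
  code_head (iter k code_tail (e 1)) == (e 0).+1) (fun e => e 1) _ _).
- move=> e; congr nat_of_bool; apply/hasP/idP => [[k _]|e0].
    rewrite /code_head decode_iter_code_tail -nth0 nth_drop addn0.
    case: (ltnP k (size (CodeSeq.decode (e 1)))) => [lt_k /eqP <-|ge_k].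
      exact: mem_nth.
    by rewrite nth_default.
  exists (index (e 0).+1 (CodeSeq.decode (e 1))).
    by rewrite mem_iota /= (leq_trans _ (size_decode _)) ?index_mem.
  by rewrite /code_head decode_iter_code_tail -nth0 nth_drop addn0 nth_index.
- apply: computable_eqn; last by apply: computable_succ; apply: computable_var.
  apply: computable_code_head.
  apply: eq_computable (@computable_rec 3 (fun e => e 2) (fun _ y _ => code_tail y)
    (fun e => e 0) _ _ _).
  + by move=> e; elim: (e 0) => //= k ->.
  + exact: computable_var.
  + by apply: computable_code_tail; apply: computable_var.
  + exact: computable_var.
- exact: computable_var.
Qed.

(** Replaces enumerations by decidable predicates with a witness [n], which combine more easily. *)
Lemma re_relP (R : nat -> nat -> Prop) :
  re_rel R <-> exists2 P : nat -> nat -> nat -> bool,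
    computable 3 (fun e => P (e 0) (e 1) (e 2)) &
    forall x y, R x y <-> exists n, P x y n.
Proof.
split=> [[R0|[f Hf Rf]]|[P HP RP]].
- exists (fun _ _ _ => false); first exact: computable_const.
  move=> x y; split=> [Rxy|[]//].
  suff: set0 (CodeSeq.code [:: x; y]) by [].
  by rewrite -R0; exists (x, y).
- exists (fun x y n => f n == CodeSeq.code [:: x; y]).
    apply: computable_eqn; first apply: computable_app1 Hf _.
      exact: computable_var.
    apply: computable_code_cons; first exact: computable_var.
    by apply: computable_code_cons; [apply: computable_var|apply: computable_const].
  move=> x y; split=> [Rxy|[n /eqP fn]].
    have : range f (CodeSeq.code [:: x; y]) by rewrite -Rf; exists (x, y).
    by case=> n _ fn; exists n; apply/eqP.
  have : range f (CodeSeq.code [:: x; y]) by exists n.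
  rewrite -Rf => -[[x' y'] Rxy E].
  by have [<- <-] : [:: x'; y'] = [:: x; y] := can_inj CodeSeq.codeK E.
(* The enumeration reads its argument as a triple of a pair and a witness. It is total, so it needs
   a member of [R] to output when the witness fails. *)
case: (pselect (exists x y, R x y)) => [[x0 [y0 R0]]|nR]; last first.
  left; apply/seteqP; split=> // z [[x y] /= Rxy _].
  by apply: nR; exists x, y.
right; pose x_ z := code_head z; pose y_ z := code_head (code_tail z).
pose n_ z := code_head (code_tail (code_tail z)).
exists (fun z => if P (x_ z) (y_ z) (n_ z) then CodeSeq.code [:: x_ z; y_ z]
                 else CodeSeq.code [:: x0; y0]).
  apply/recursiveE; have Hx : computable 1 (fun e => x_ (e 0)).
    by apply: computable_code_head; apply: computable_var.
  have Hy : computable 1 (fun e => y_ (e 0)).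
    by apply/computable_code_head/computable_code_tail/computable_var.
  apply: computable_if.
  - apply: (@computable_app3 1 (fun x y z => P x y z) _ _ _ HP Hx Hy).
    apply: computable_code_head.
    by do 2!apply: computable_code_tail; apply: computable_var.
  - apply: computable_code_cons => //.
    by apply: computable_code_cons => //; apply: computable_const.
  - exact: computable_const.
apply/seteqP; split=> [z [[x y] /= /RP[n Pn] <-]|z [w _ <-]].
  exists (CodeSeq.code [:: x; y; n]) => //.
  by rewrite /n_ /y_ /x_ !code_tail_cons !code_head_cons Pn.
case: ifP => [Pw|_]; last by exists (x0, y0).
by exists (x_ w, y_ w) => //=; apply/RP; exists (n_ w).
Qed.

(** * Finite sets and tell-tales *)

(** Entries can only be put in front, so the recursion runs from the last entry to the first. *)
Lemma computable_code_mkseq (T : nat -> nat -> nat) :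
  computable 2 (fun e => T (e 0) (e 1)) ->
  computable 2 (fun e => CodeSeq.code (mkseq (T (e 0)) (e 1))).
Proof.
move=> HT.
apply: eq_computable (@computable_rec 2 (fun=> 0)
  (fun j y e => 2 ^ T (e 0) (e 1 - j.+1) * y.*2.+1) (fun e => e 1) _ _ _).
- move=> e; set rec := nat_rect _ _ _.
  suff H j : j <= e 1 ->
      rec j = CodeSeq.code (map (T (e 0)) (iota (e 1 - j) j)).
    by rewrite H // subnn.
  elim: j => [//|j IHj] j_lt /=.
  by rewrite IHj 1?ltnW // subnSK.
- exact: computable_const.
- apply: computable_code_cons; last exact: computable_var.
  apply: (computable_app2 HT); first exact: computable_var.
  apply: computable_sub; first exact: computable_var.
  by apply: computable_succ; apply: computable_var.
- exact: computable_var.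
Qed.

(** Ensures that a search bounded by the code of a segment keeps its range as the text goes on. *)
Lemma leq_code_take n s : CodeSeq.code (take n s) <= CodeSeq.code s.
Proof.
elim: s n => // x s IHs [|n] //=; rewrite leq_pmul2l ?expn_gt0 //.
by rewrite ltnS leq_double.
Qed.

(* Finite sets are coded like text segments: [x] is listed as [x.+1], and [0]
   is a pause. *)
Definition content (c : nat) : set nat := [set x | x.+1 \in CodeSeq.decode c].

Lemma content_segment s x : content (code_segment s) x <-> Some x \in s.
Proof.
rewrite /content /= /code_segment CodeSeq.codeK.
by rewrite -[x.+1]/(code_option (Some x)) mem_map // => -[a|] [b|] //= [->].
Qed.

Lemma content_lt c x : content c x -> x < c.
Proof. by move=> /(allP (CodeSeq.gtn_decode c)); apply: ltnW. Qed.

Definition content_sub (c c' : nat) : bool :=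
  all (fun y => ~~ (y.+1 \in CodeSeq.decode c) || (y.+1 \in CodeSeq.decode c'))
    (iota 0 c).

Lemma content_subP c c' : reflect (content c `<=` content c') (content_sub c c').
Proof.
apply: (iffP allP) => [sub x cx|sub x _]; last first.
  by case: (boolP (x.+1 \in _)) => //= /sub.
have /sub : x \in iota 0 c by rewrite mem_iota content_lt.
by move: cx; rewrite /content /= => ->.
Qed.

Lemma computable_content_sub n F G : computable n F -> computable n G ->
  computable n (fun e => content_sub (F e) (G e)).
Proof.
apply: (@computable_app2 n content_sub).
apply: (@computable_all 2 (fun y e => ~~ (y.+1 \in CodeSeq.decode (e 0))
  || (y.+1 \in CodeSeq.decode (e 1))) (fun e => e 0)); last exact: computable_var.
apply: computable_orb; last by apply: computable_mem_decode; apply: computable_var.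
by apply: computable_negb; apply: computable_mem_decode; apply: computable_var.
Qed.

(** * Finite learning and independent sequences of finite sets *)

Section Learning.

Variables (W : nat -> set nat) (eta : nat -> nat -> Prop).
Hypothesis eta_equiv : RelationClasses.Equivalence eta.

Local Notation closure := (eta_closure eta).

Let eta_refl x : eta x x. Proof. by case: eta_equiv. Qed.
Let eta_sym x y : eta x y -> eta y x.
Proof. by case: eta_equiv => _ + _; apply. Qed.
Let eta_trans x y z : eta x y -> eta y z -> eta x z.
Proof. by case: eta_equiv => _ _; apply. Qed.

Lemma sub_eta_closure A : A `<=` closure A.
Proof. by move=> x Ax; exists x. Qed.

Lemma eta_closure_sub A B : A `<=` closure B -> closure A `<=` closure B.
Proof.
move=> AB y [x /AB[z Bz /= zx] /= xy]; exists z => //=; exact: eta_trans zx xy.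
Qed.

Lemma eta_closureK A : closure (closure A) = closure A.
Proof.
by apply/seteqP; split; [apply: eta_closure_sub | apply: sub_eta_closure].
Qed.

Lemma eta_closed_closure A : eta_closed eta (closure A).
Proof.
exists (eta_class eta @` A); first by move=> _ [x _ <-]; exists x.
by rewrite bigcup_image.
Qed.

Lemma eta_closureE A : eta_closed eta A -> closure A = A.
Proof.
move=> [S Scls ->]; apply/seteqP; split; last exact: sub_eta_closure.
move=> y [x [C SC Cx] /= xy]; exists C => //.
case: (Scls C SC) Cx => z _ <- /= zx; exact: eta_trans zx xy.
Qed.

Definition learns (M : seq (option nat) -> option nat) (L : set (set nat)) : Prop :=
  forall A, L A -> forall T, text_for T A ->
    exists n, [/\ forall m, m < n -> M (mkseq T m) = None,
      forall j, n <= j -> M (mkseq T j) = M (mkseq T n)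
      & exists2 e, M (mkseq T n) = Some e & closure (W e) = A].

Lemma text_extending (s : seq (option nat)) (A : set nat) :
  (forall x, Some x \in s -> A x) ->
  exists2 T, text_for T A & mkseq T (size s) = s.
Proof.
move=> sA.
pose t j := if `[< A j >] then Some j else None.
(* The default value of [nth] does the gluing: past the end of [s], the text [t] of [A] is read from
   its start. *)
exists (fun j => nth (t (j - size s)) s j); last first.
  apply: (@eq_from_nth _ None); rewrite size_mkseq // => j j_lt.
  by rewrite nth_mkseq //; apply: set_nth_default.
apply/seteqP; split=> [x Ax|x [j] /=].
  exists (x + size s); rewrite nth_default ?leq_addl // addnK /t.
  by case: asboolP.
case: (ltnP j (size s)) => [j_lt Tj|j_ge].
  by apply: sA; rewrite -Tj; apply: mem_nth.
by rewrite nth_default // /t; case: asboolP => // Aj [xj]; rewrite -xj.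
Qed.

(* A finite learner never revises its first hypothesis, so it must already be
   right for every language of the class consistent with the segment read. *)
Lemma learns_lock M L A s e : learns M L -> L A ->
  (forall x, Some x \in s -> A x) -> M s = Some e -> closure (W e) = A.
Proof.
move=> ML LA sA Ms; have [T TA Ts] := text_extending sA.
have [n [Mlt Mge [e' Me' We']]] := ML A LA T TA.
case: (leqP n (size s)) => [/Mge|/Mlt]; rewrite Ts Ms // Me' => -[ee'].
by rewrite ee'.
Qed.

Lemma learns_hypothesis M L A T : learns M L -> L A -> text_for T A ->
  exists n, M (mkseq T n).
Proof.
by move=> ML LA TA; have [n [_ _ [e Me _]]] := ML A LA T TA; exists n; rewrite Me.
Qed.

Lemma text_segment_sub T A n x : text_for T A -> Some x \in mkseq T n -> A x.
Proof. by move=> -> /mapP[m _ xT]; exists m. Qed.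

(** The segment of a text for [A] that yields a hypothesis is consistent with [B] too, so the
    hypothesis would have to be right for both. *)
Lemma not_finitely_learnable_sub L A B : L A -> L B -> A `<=` B -> A <> B ->
  ~ finitely_learnable W eta L.
Proof.
move=> LA LB AB neAB [M _ ML].
have [//|T TA _] := @text_extending [::] A.
have [n Mn] := learns_hypothesis ML LA TA; apply: neAB.
case Me: (M (mkseq T n)) Mn => [e|//] _.
have sA x : Some x \in mkseq T n -> A x by apply: text_segment_sub.
rewrite -(learns_lock ML LA sA Me); apply: learns_lock ML LB _ Me => x /sA.
exact: AB.
Qed.

(** Equivalently, the closures form an antichain indexed without repetition; each finite set is then
    a tell-tale for its closure. *)
Definition independent (d : nat -> nat) : Prop :=
  forall i j, content (d i) `<=` closure (content (d j)) -> i = j.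

Lemma independent_inj d :
  independent d -> injective (fun i => closure (content (d i))).
Proof. by move=> ind i j Eij; apply: ind; rewrite -Eij; apply: sub_eta_closure. Qed.

Lemma re_rel_closure_content d : re_rel eta -> recursive d ->
  re_rel (fun i => closure (content (d i))).
Proof.
move=> /re_relP[P HP etaP] Hd; apply/re_relP.
(* The witness [w] codes an element of the finite set and a witness for its equivalence with [x]. *)
exists (fun i x w => ((code_head w).+1 \in CodeSeq.decode (d i))
                     && P (code_head w) x (code_head (code_tail w))).
  have Hw : computable 3 (fun e => code_head (e 2)).
    by apply: computable_code_head; apply: computable_var.
  apply: computable_andb.
    apply: computable_mem_decode => //.
    by apply: computable_app1 => //; apply: computable_var.
  apply: (@computable_app3 3 (fun x y z => P x y z) _ _ _ HP Hw).
    exact: computable_var.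
  by apply/computable_code_head/computable_code_tail/computable_var.
move=> i x; split=> [[y dy /= /etaP[n Pn]]|[w /andP[wd Pw]]]; last first.
  by exists (code_head w) => //=; apply/etaP; exists (code_head (code_tail w)).
exists (CodeSeq.code [:: y; n]).
by rewrite code_tail_cons !code_head_cons Pn andbT.
Qed.

Lemma eta_family_content d : re_rel eta -> recursive d ->
  injective (fun i => closure (content (d i))) ->
  eta_family eta (range (fun i => closure (content (d i)))).
Proof.
move=> re_eta Hd inj_d; split.
- rewrite (eq_finite_set (inj_card_eq _)); first exact: infinite_nat.
  by move=> i j _ _; apply: inj_d.
- by move=> _ [i _ <-]; apply: eta_closed_closure.
- exists (fun i => closure (content (d i))); split=> //.
  exact: re_rel_closure_content.
Qed.

(* The learner conjectures the first [i], bounded by the code of the segment,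
   such that the segment contains [content (d i)] itself: no search through
   [eta] is needed, and on a text for the [i]-th language only [i] qualifies. *)
Lemma independent_learnable d : acceptable W -> re_rel eta ->
  recursive d -> independent d ->
  finitely_learnable W eta (range (fun i => closure (content (d i)))).
Proof.
move=> [_ accW] re_eta Hd ind.
have [g Hg Wg] := accW _ (re_rel_closure_content re_eta Hd).
(* An unsuccessful search returns [c.+1], so [first c <= c] expresses success. *)
pose first c := find (fun i => content_sub (d i) c) (iota 0 c.+1).
have Hfirst : computable 1 (fun e => first (e 0)).
  apply: (@computable_find 1 (fun i e => content_sub (d i) (e 0))
    (fun e => (e 0).+1)).
    apply: computable_content_sub; last exact: computable_var.
    by apply: computable_app1 => //; apply: computable_var.
  by apply: computable_succ; apply: computable_var.
pose f c := if first c <= c then (g (first c)).+1 else 0.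
pose M s := let c := code_segment s in
  if first c <= c then Some (g (first c)) else None.
exists M.
  exists f; last by move=> s; rewrite /f /M; case: ifP.
  apply/recursiveE; apply: computable_if; last exact: computable_const.
    by apply: computable_leq => //; apply: computable_var.
  by apply: computable_succ; apply: computable_app1.
move=> _ [i _ <-] T TA.
pose c n := code_segment (mkseq T n).
have sub_c j n : content_sub (d j) (c n) -> j = i.
  move=> /content_subP sub; apply: ind => x /sub /content_segment.
  exact: text_segment_sub.
(* [M] conjectures exactly on the good segments, always with index [g i]. As goodness persists, the
   least good [n] is the required one. *)
pose good n := (i <= c n) && content_sub (d i) (c n).
have Mgood n : M (mkseq T n) = if good n then Some (g i) else None.
  have lt_has : (first (c n) <= c n)
      = has (fun j => content_sub (d j) (c n)) (iota 0 (c n).+1).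
    by rewrite has_find size_iota.
  have first_sub : first (c n) <= c n -> content_sub (d (first (c n))) (c n).
    move=> le_c; move: (le_c); rewrite lt_has => /(nth_find 0).
    by rewrite -/(first _) nth_iota.
  rewrite /M -/(c n); case: ifP => [le_c|gt_c].
    by rewrite /good -(sub_c _ _ (first_sub le_c)) le_c first_sub.
  case: ifP => // /andP[le_i sub_i]; move: gt_c; rewrite lt_has => /hasPn/(_ i).
  by rewrite mem_iota sub_i => /(_ le_i).
have c_take m n : m <= n -> mkseq T m = take m (mkseq T n).
  by move=> mn; rewrite -map_take take_iota (minn_idPl mn).
have good_mono m n : m <= n -> good m -> good n.
  move=> mn /andP[im /content_subP dm]; apply/andP; split.
    apply: leq_trans im _; rewrite /c /code_segment (c_take m n) // map_take.
    exact: leq_code_take.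
  apply/content_subP => x /dm /content_segment; rewrite (c_take m n) //.
  by move=> /mem_take xn; apply/content_segment.
have ex_good : exists n, good n.
  (* Elements of [content (d i)] are below [d i]; induction on this bound finds a segment containing
     them all. *)
  have [n dn] : exists n, forall x, x < d i -> content (d i) x -> content (c n) x.
    elim: {1}(d i) => [|k [n Hn]]; first by exists 0.
    case: (pselect (content (d i) k)) => [dk|ndk]; last first.
      by exists n => x; rewrite ltnS leq_eqVlt => /orP[/eqP-> //|/Hn].
    have := sub_eta_closure dk; rewrite TA => -[m Tm].
    exists (maxn n m.+1) => x; rewrite ltnS leq_eqVlt => /orP[/eqP-> _|xk dx].
      apply/content_segment; rewrite -Tm; apply: map_f.
      by rewrite mem_iota leq_max ltnSn orbT.
    have /content_segment := Hn x xk dx.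
    by rewrite (c_take _ _ (leq_maxl n m.+1)) => /mem_take ?; apply/content_segment.
  (* A code is at least the length of its sequence, so length [i] suffices to bring [i] within the
     search bound. *)
  exists (maxn n i); apply/andP; split.
    apply: leq_trans (leq_maxr n i) _; rewrite -{1}(size_mkseq T (maxn n i)).
    rewrite -(size_map code_option) -(CodeSeq.codeK (map _ _)).
    exact: size_decode.
  apply/content_subP => x dx; have /content_segment := dn x (content_lt dx) dx.
  rewrite (c_take _ _ (leq_maxl n i)) => /mem_take xn; exact/content_segment.
case: (ex_minnP ex_good) => n gn n_min; exists n; split.
- by move=> m mn; rewrite Mgood; case: ifP => // /n_min; rewrite leqNgt mn.
- by move=> j nj; rewrite !Mgood gn (good_mono n j).
- by exists (g i); rewrite ?Mgood ?gn // Wg eta_closureK.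
Qed.

(** The numbering gives uniformly computable texts for the [B i]. The segment up to the first
    hypothesis of [M] is found by search, and locking makes it a tell-tale. *)
Lemma learnable_independent L : eta_family eta L -> finitely_learnable W eta L ->
  exists2 d, recursive d & independent d.
Proof.
move=> [_ Lclosed [B [LB injB /re_relP[P HP BP]]]] [M [f Hf fM] ML].
(* Entry [n] is read as a pair: it lists the first component if the second witnesses its membership
   in [B i], and pauses otherwise. [TT] is the coded form of [T]. *)
pose TT i n := let x := code_head n in
  if P i x (code_head (code_tail n)) then x.+1 else 0.
pose T i n := let x := code_head n in
  if P i x (code_head (code_tail n)) then Some x else None.
have LBi i : L (B i) by rewrite LB; exists i.
have TB i : text_for (T i) (B i).
  apply/seteqP; split=> [x /BP[n Pn]|x [n]] /=.
    exists (CodeSeq.code [:: x; n]).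
    by rewrite /T code_tail_cons !code_head_cons Pn.
  by rewrite /T; case: ifP => // Pn [<-]; apply/BP; eexists; apply: Pn.
pose seg i n := CodeSeq.code (mkseq (TT i) n).
have segE i n : seg i n = code_segment (mkseq (T i) n).
  rewrite /code_segment /mkseq -map_comp; congr CodeSeq.code; apply: eq_map => m.
  by rewrite /= /TT /T; case: ifP.
have Hseg : computable 2 (fun e => seg (e 0) (e 1)).
  apply: computable_code_mkseq.
  have Hh : computable 2 (fun e => code_head (e 1)).
    by apply: computable_code_head; apply: computable_var.
  apply: computable_if; last exact: computable_const.
    apply: (@computable_app3 2 (fun x y z => P x y z) _ _ _ HP _ Hh).
      exact: computable_var.
    by apply/computable_code_head/computable_code_tail/computable_var.
  exact: computable_succ.
(* The symbol ? is coded by 0, so a nonzero value of [f] detects a hypothesis. *)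
have fseg i n : (f (seg i n) != 0) = M (mkseq (T i) n) :> bool.
  by rewrite segE fM; case: (M _).
have ex_N i : exists n, f (seg i n) != 0.
  by have [n Mn] := learns_hypothesis ML (LBi i) (TB i); exists n; rewrite fseg.
pose N i := ex_minn (ex_N i).
have HN : computable 1 (fun e => N (e 0)).
  apply: (@computable_mu 1 (fun n e => f (seg (e 0) n) != 0)).
  - apply/computable_negb/computable_negb/computable_eqn; last first.
      exact: computable_const.
    apply: computable_app1 => //.
    by apply: (computable_app2 Hseg); apply: computable_var.
  - by move=> e; rewrite /N; case: ex_minnP.
  - by move=> e m fm; rewrite /N; case: ex_minnP => n _; apply.
exists (fun i => seg i (N i)).
  by apply/recursiveE; apply: (computable_app2 Hseg _ HN); apply: computable_var.
have sB i x : Some x \in mkseq (T i) (N i) -> B i x by apply: text_segment_sub.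
have cB i : closure (content (seg i (N i))) `<=` B i.
  rewrite -[X in _ `<=` X](eta_closureE (Lclosed _ (LBi i))).
  apply: eta_closure_sub => x; rewrite segE => /content_segment/sB.
  exact: sub_eta_closure.
move=> i j dij; apply: injB.
have: M (mkseq (T i) (N i)) by rewrite -fseg /N; case: ex_minnP.
case Me: (M _) => [e|//] _.
(* The segment for [B i] is also consistent with [B j], so its single hypothesis [e] describes
   both. *)
rewrite -(learns_lock ML (LBi i) (@sB i) Me).
apply: learns_lock ML (LBi j) _ Me => x.
by move=> /content_segment; rewrite -segE => /dij/cB.
Qed.

(** Every class met by such a [content (d j)] has a representative below [c]. Hence the trace of the
    closure on the numbers below [c] determines [j], and there are finitely many traces. *)
Lemma independent_bound d c : independent d ->
  exists m, forall j, m < j -> ~ content (d j) `<=` closure (content c).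
Proof.
move=> ind; pose J := [set j | content (d j) `<=` closure (content c)].
pose mask j := [ffun x : 'I_c => `[< closure (content (d j)) x >]].
have inj_mask : {in J &, injective mask}.
  move=> i j; rewrite !inE => Ji Jj Eij; apply: ind => y dy.
  have [x cx xy] := Ji y dy.
  have := congr1 (fun g : {ffun _} => g (Ordinal (content_lt cx))) Eij.
  rewrite !ffunE /= => Exx.
  have : closure (content (d i)) x by exists y => //; apply: eta_sym.
  move/asboolP; rewrite Exx => /asboolP[z dz zx]; exists z => //=.
  exact: eta_trans zx xy.
have /finite_seqP[s Js] : finite_set J.
  by rewrite -(eq_finite_set (inj_card_eq inj_mask)); apply: finite_finset.
exists (\max_(j <- s) j) => j lt_j Jj.
have js : [set` s] j by rewrite -Js.
by have := leq_bigmax_seq (P := xpredT) (F := id) j js isT; rewrite leqNgt lt_j.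
Qed.

End Learning.

(** * Unions of finite sets and changes to recursive sequences *)

Definition content_union (c c' : nat) : nat :=
  CodeSeq.code (CodeSeq.decode c ++ CodeSeq.decode c').

Lemma content_unionE c c' :
  content (content_union c c') = content c `|` content c'.
Proof.
rewrite /content /content_union CodeSeq.codeK; apply/seteqP.
by split=> x /=; rewrite mem_cat => /orP.
Qed.

Definition prepend (c : nat) (d : nat -> nat) (i : nat) : nat :=
  if i == 0 then c else d i.-1.

Lemma recursive_prepend c d : recursive d -> recursive (prepend c d).
Proof.
move=> Hd; apply/recursiveE; apply: computable_if; last 2 first.
- exact: computable_const.
- by apply: computable_app1 => //; apply: computable_pred; apply: computable_var.
by apply: computable_eqn; [apply: computable_var | apply: computable_const].
Qed.

Lemma range_prepend (E : nat -> set nat) c d :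
  range (fun i => E (prepend c d i)) = E c |` range (fun i => E (d i)).
Proof.
apply/seteqP; split=> [_ [[|i] _ <-]|_ [->|[i _ <-]]].
- by left.
- by right; exists i.
- by exists 0.
- by exists i.+1.
Qed.

Lemma recursive_shift k d : recursive d -> recursive (fun i => d (i + k)).
Proof.
move=> Hd; apply/recursiveE; apply: computable_app1 => //.
by apply: computable_add; [apply: computable_var | apply: computable_const].
Qed.

Set Strict Implicit.
Unset Implicit Arguments.

Theorem theorem7 (W : nat -> set nat) (eta : nat -> nat -> Prop) :
  acceptable W ->
  positive_equivalence eta ->
  (exists L : set (set nat), eta_family eta L /\ finitely_learnable W eta L) ->
  exists L1 L2 : set (set nat),
    (eta_family eta L1 /\ finitely_learnable W eta L1) /\
    (eta_family eta L2 /\ finitely_learnable W eta L2) /\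
    eta_family eta (L1 `|` L2) /\
    ~ finitely_learnable W eta (L1 `|` L2) /\
    (exists A : set nat, L2 `\` L1 = [set A]).
Proof.
move=> accW [eta_equiv re_eta _] [L [Lfam Llearn]].
have [d Hd ind] := learnable_independent eta_equiv Lfam Llearn.
pose E c := eta_closure eta (content c).
pose u := content_union (d 0) (d 1).
have [m m_bound] := independent_bound eta_equiv u ind.
(* All indices of the tail are above [m], which keeps its members out of [E u], and above the
   indices 0 and 1 merged in [u]. *)
pose t i := d (i + m.+2).
have Ht : recursive t by apply: recursive_shift.
have d0u : content (d 0) `<=` content u.
  by rewrite content_unionE; apply: subsetUl.
have d1u : content (d 1) `<=` content u.
  by rewrite content_unionE; apply: subsetUr.
have u_t i : ~ content u `<=` E (t i).
  by move=> /(subset_trans d0u)/ind; rewrite addnS.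
have t_u i : ~ content (t i) `<=` E u.
  by apply: m_bound; rewrite !addnS ltnS ltnW ?ltnS ?leq_addl.
(* Here [d 1] serves to make the inclusion of [E (d 0)] in [E u] proper. *)
have u_0 : ~ content u `<=` E (d 0) by move=> /(subset_trans d1u)/ind.
have subE c : content c `<=` E c by apply: sub_eta_closure.
have neu0 : E u <> E (d 0) by move=> Eu; apply: u_0; rewrite -Eu.
have neut i : E u <> E (t i) by move=> Eu; apply: (u_t i); rewrite -Eu.
have ind_t : independent eta t by move=> i j /ind/addIn.
have ind0 : independent eta (prepend (d 0) t).
  by move=> [|i] [|j] //= => [/ind|/ind|/ind_t /= ->] //; rewrite addnS.
have indu : independent eta (prepend u t).
  by move=> [|i] [|j] //= => [/u_t|/t_u|/ind_t /= ->].
have family c : independent eta (prepend c t) ->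
    eta_family eta (E c |` range (fun i => E (t i))) /\
    finitely_learnable W eta (E c |` range (fun i => E (t i))).
  move=> ind_c; rewrite -range_prepend; have Hc := recursive_prepend c Ht.
  split; last exact: independent_learnable.
  by apply: eta_family_content => //; apply: independent_inj.
have unionE : (E (d 0) |` range (fun i => E (t i))) `|`
    (E u |` range (fun i => E (t i))) =
    range (fun i => E (prepend u (prepend (d 0) t) i)).
  by rewrite !range_prepend setUACA setUid (setUC [set E (d 0)]) -setUA.
exists (E (d 0) |` range (fun i => E (t i))), (E u |` range (fun i => E (t i))).
split; first exact: family; split; first exact: family.
split; last split.
(* The combined sequence is not independent, since [E u] includes [content (d 0)]; injectivity is
   therefore checked case by case. *)
- rewrite unionE; apply: eta_family_content => //.
    by do 2!apply: recursive_prepend.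
  have inj0 := independent_inj eta_equiv ind0.
  have injt := independent_inj eta_equiv ind_t.
  move=> [|[|i]] [|[|j]] //=; rewrite /prepend /= => Eij.
  + by case: (neut j).
  + by case: neu0.
  + by have := inj0 0 j.+1 Eij.
  + by case: (neut i).
  + by have := inj0 i.+1 0 Eij.
  + by rewrite (injt _ _ Eij).
- apply: (@not_finitely_learnable_sub W eta _ (E (d 0)) (E u)).
  + by left; left.
  + by right; left.
  + by apply: eta_closure_sub => //; apply: subset_trans (subE u).
  + by move=> /esym.
- exists (E u); apply/seteqP; split=> [A [[//|At] nA]|_ ->].
    by case: nA; right.
  split; first by left.
  by case=> [/neu0|[i _ /esym/neut]].
Qed.
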